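(* Let $\mathcal{H}$ be a separable complex Hilbert space, let $C\in GL(\mathcal{H})$ and let $\Lambda=\{\Lambda_i\}_{i\in J}$, $\Lambda_i\in\mathcal{L}(\mathcal{H},\mathcal{H}_i)$, be a $C$-controlled g-frame in $\mathcal{H}$. Then $\Lambda$ is a (classical) g-frame for $\mathcal{H}$. Furthermore, if $S$ is the g-frame operator of $\Lambda$, then $SC^{\star}=CS$, and so $$\sum_{i\in J}\Lambda_i^{\star}\Lambda_iC^{\star}f=C\sum_{i\in J}\Lambda_i^{\star}\Lambda_if\quad\text{for all } f\in\mathcal{H}.$$
   Context: $J\subseteq\mathbb{Z}$ is an index set, $\{\mathcal{H}_i\}_{i\in J}$ is a sequence of separable complex Hilbert spaces, $\mathcal{L}(\mathcal{H},\mathcal{H}_i)$ is the set of bounded linear operators $\mathcal{H}\to\mathcal{H}_i$, and $GL(\mathcal{H})$ is the set of bounded linear operators on $\mathcal{H}$ with bounded inverse. A $C$-controlled g-frame is a family $\{\Lambda_i\}_{i\in J}$, $\Lambda_i\in\mathcal{L}(\mathcal{H},\mathcal{H}_i)$, for which there exist constants $m_{CL}>0$ and $M_{CL}<\infty$ with $m_{CL}\|f\|^2\le\sum_{i\in J}\langle\Lambda_iC^{\star}f,\Lambda_if\rangle\le M_{CL}\|f\|^2$ for all $f\in\mathcal{H}$ (the sum being required to converge to a real number). A family is a (classical) g-frame if there are $A,B>0$ with $A\|f\|^2\le\sum_{i\in J}\|\Lambda_if\|^2\le B\|f\|^2$ for all $f\in\mathcal{H}$; its g-frame operator is $Sf=\sum_{i\in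 J}\Lambda_i^{\star}\Lambda_if$. *)

(* Defs.v *)
From HB Require Import structures.
From mathcomp Require Import all_boot all_order all_algebra.
From mathcomp Require Import sesquilinear complex finmap.
From mathcomp Require Import all_classical all_reals all_analysis.
From mathcomp.analysis.showcase Require Export summability.

Set Implicit Arguments.
Unset Strict Implicit.
Unset Printing Implicit Defensive.
Import Order.TTheory GRing.Theory Num.Theory.
Import numFieldNormedType.Exports.

Local Open Scope classical_set_scope.
Local Open Scope ring_scope.
Local Open Scope complex_scope.

(* A complex Hilbert space is a Banach space over R[i] whose norm comes from an
   inner product, linear in its first argument and conjugate-linear in its
   second.  The norm of MathComp-Analysis is R[i]-valued. *)
HB.mixin Record CompleteNormedModule_isHilbert (R : realType) H
    of CompleteNormedModule R[i] H := {
  hdot : {dot H for (@Num.conj R[i])} ;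
  hdot_normE : forall x : H, `|x| ^+ 2 = hdot x x
}.

#[short(type="hilbertType")]
HB.structure Definition Hilbert (R : realType) :=
  { H of CompleteNormedModule R[i] H & CompleteNormedModule_isHilbert R H }.

Definition separable (T : topologicalType) : Prop :=
  exists D : set T, countable D /\ dense D.

Section operators.
Variables (R : realType).
Implicit Types H K : hilbertType R.

Definition bounded_op H K (T : H -> K) : Prop :=
  exists M : R, forall x, `|T x| <= M%:C * `|x|.

Definition in_GL H (C : {linear H -> H}) : Prop :=
  bounded_op C /\
  exists D : {linear H -> H}, [/\ bounded_op D, cancel C D & cancel D C].

(* The Hilbert space adjoint; for linear T with [bounded_op T] the vector
   selected here exists (Riesz) and is unique. *)
Definition adjoint H K (T : H -> K) (y : K) : H :=
  xget 0 [set z | forall x, hdot (T x) y = hdot x z].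

End operators.

Section gframes.
Variables (R : realType) (J : set int).
Variables (H : hilbertType R) (K : J -> hilbertType R).
Variable Lam : forall i : J, {linear H -> K i}.

(* [F] is the filter on the finite subsets of J along which the partial sums
   are taken: [totally] for unordered summation, or the image of [\oo] under an
   exhaustion of J by finite sets for an ordered series.  It is a parameter
   because the terms need not be nonnegative, so that the mode of summation is
   not a priori irrelevant.  The limit is required to be a real number [s]. *)
Definition controlled_gframe (F : set_system {fset J}) (C : H -> H) : Prop :=
  exists m M : R, 0 < m /\
    forall f : H, exists s : R,
      [/\ partial_sum
            (fun i => hdot (Lam i (adjoint C f)) (Lam i f) : R[i]^o) @ F
            --> (s%:C : R[i]^o),
          m%:C * `|f| ^+ 2 <= s%:C
        & s%:C <= M%:C * `|f| ^+ 2].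

Definition gframe : Prop :=
  exists A B : R, [/\ 0 < A, 0 < B &
    forall f : H, exists s : R,
      [/\ partial_sum (fun i => `|Lam i f| ^+ 2 : R[i]^o) @ totally
            --> (s%:C : R[i]^o),
          A%:C * `|f| ^+ 2 <= s%:C
        & s%:C <= B%:C * `|f| ^+ 2]].

Definition gframe_series (f : H) : J -> H :=
  fun i => adjoint (Lam i) (Lam i f).

Definition gframe_op (f : H) : H := sum (gframe_series f).

End gframes.

(* Main.v *)
(* Write S_A for the partial sum of Lam_i^* Lam_i over a finite set A.  The
   controlled form q(f) = lim <S_A C^* f, f> is real, so its polarization is
   Hermitian and lim <S_A C^* f, g> exists for all f and g.  Since C^* is
   onto, f can be chosen with C^* f = h, g = h: the increasing net <S_A h, h>
   is bounded by b |h|^2.  For the positive operators S_E with S_E <= b,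
   |S_E f|^2 <= b <S_E f, f>, hence S_A converges strongly to S.
   Cauchy-Schwarz applied to m |f|^2 <= <S C^* f, f> gives the lower frame
   bound, and the symmetry of the limit form reads S C^* = C S.  Only real
   parts of inner products are needed for all of this. *)

Require Import Defs.
From mathcomp Require Import all_boot all_order all_algebra.
From mathcomp Require Import sesquilinear complex finmap.
From mathcomp Require Import all_classical all_reals all_analysis.
From mathcomp Require Import ring lra.
Set Implicit Arguments.
Unset Strict Implicit.
Unset Printing Implicit Defensive.
Import Order.TTheory GRing.Theory Num.Theory.
Import numFieldNormedType.Exports.
Local Open Scope classical_set_scope.
Local Open Scope ring_scope.
Local Open Scope complex_scope.

(** * Real and imaginary parts of complex numbers *)

Section ComplexParts.
Variable R : realType.
Implicit Types (u v : R[i]) (a : R).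

Lemma ReD u v : complex.Re (u + v) = complex.Re u + complex.Re v.
Proof. by case: u v => ? ? []. Qed.

Lemma ImD u v : complex.Im (u + v) = complex.Im u + complex.Im v.
Proof. by case: u v => ? ? []. Qed.

Lemma ReN u : complex.Re (- u) = - complex.Re u.
Proof. by case: u. Qed.

Lemma ReZ a u : complex.Re (a%:C * u) = a * complex.Re u.
Proof. by case: u => ? ? /=; rewrite mul0r subr0. Qed.

Lemma Rei u : complex.Re ('i * u) = - complex.Im u.
Proof. by case: u => ? ? /=; ring. Qed.

Lemma Imi u : complex.Im ('i * u) = complex.Re u.
Proof. by case: u => ? ? /=; ring. Qed.

Lemma ReJ u : complex.Re u^*%C = complex.Re u.
Proof. by case: u. Qed.

Lemma ImJ u : complex.Im u^*%C = - complex.Im u.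
Proof. by case: u. Qed.

End ComplexParts.

(** * The real inner product underlying [hdot] *)

Section RealInnerProduct.
Variables (R : realType) (H : hilbertType R).
Implicit Types (x y z : H) (a : R).

(** Order and limits are handled on this real form; [rdot_complexE] recovers [hdot] from it. *)
Definition rdot x y : R := complex.Re (hdot x y).
Definition rnorm x : R := complex.Re `|x|.

Lemma hdotC x y : hdot x y = (hdot y x)^*%C.
Proof. by rewrite hermC expr0 mul1r. Qed.

Lemma rdotC x y : rdot x y = rdot y x.
Proof. by rewrite /rdot hdotC ReJ. Qed.

Lemma rdotDl x y z : rdot (x + y) z = rdot x z + rdot y z.
Proof. by rewrite /rdot linearDl ReD. Qed.

Lemma rdotNl x z : rdot (- x) z = - rdot x z.
Proof. by rewrite /rdot linearNl ReN. Qed.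

Lemma rdotZl a x z : rdot (a%:C *: x) z = a * rdot x z.
Proof. by rewrite /rdot linearZl_LR ReZ. Qed.

Lemma rdotDr x y z : rdot z (x + y) = rdot z x + rdot z y.
Proof. by rewrite rdotC rdotDl !(rdotC _ z). Qed.

Lemma rdotNr x z : rdot z (- x) = - rdot z x.
Proof. by rewrite rdotC rdotNl rdotC. Qed.

Lemma rdotZr a x z : rdot z (a%:C *: x) = a * rdot z x.
Proof. by rewrite rdotC rdotZl rdotC. Qed.

Lemma rdot0l z : rdot 0 z = 0.
Proof. by rewrite -(subrr z) rdotDl rdotNl subrr. Qed.

Lemma rdot_suml I (r : seq I) (P : pred I) (F : I -> H) z :
  rdot (\sum_(i <- r | P i) F i) z = \sum_(i <- r | P i) rdot (F i) z.
Proof. by elim/big_rec2: _ => [|i u v _ <-]; rewrite ?rdot0l ?rdotDl. Qed.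

Lemma rdotil x y : rdot ('i *: x) y = - complex.Im (hdot x y).
Proof. by rewrite /rdot linearZl_LR Rei. Qed.

Lemma rdotir x y : rdot x ('i *: y) = complex.Im (hdot x y).
Proof. by rewrite rdotC rdotil hdotC ImJ opprK. Qed.

Lemma rdotii x y : rdot ('i *: x) ('i *: y) = rdot x y.
Proof. by rewrite rdotir linearZl_LR Imi. Qed.

Lemma rdot_complexE x y : hdot x y = rdot x y +i* rdot x ('i *: y).
Proof. by rewrite rdotir /rdot; case: (hdot x y). Qed.

Lemma rnormE x : `|x| = (rnorm x)%:C.
Proof. by rewrite /rnorm RRe_real // realE normr_ge0. Qed.

Lemma rnorm_ge0 x : 0 <= rnorm x.
Proof. by rewrite -ler0c -rnormE normr_ge0. Qed.

Lemma rnorm2 x : rnorm x ^+ 2 = rdot x x.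
Proof. by rewrite /rdot -hdot_normE rnormE -rmorphXn. Qed.

Lemma rnorm0_eq0 x : rnorm x = 0 -> x = 0.
Proof. by move=> x0; apply/eqP; rewrite -normr_eq0 rnormE x0. Qed.

Lemma rnormD x y : rnorm (x + y) <= rnorm x + rnorm y.
Proof. by rewrite -lecR rmorphD /= -!rnormE ler_normD. Qed.

Lemma rnormN x : rnorm (- x) = rnorm x.
Proof. by rewrite /rnorm normrN. Qed.

End RealInnerProduct.

(** * Discriminants and real radii *)

(** The common core of Cauchy-Schwarz for [rdot], for the semidefinite form [gram], and of the
    variational step in [real_riesz]. *)
Lemma discriminant_le (R : realFieldType) (a b c : R) : 0 <= c ->
  (forall t, 0 <= a + 2 * t * b + t ^+ 2 * c) -> b ^+ 2 <= a * c.
Proof.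
(* For [c = 0] the polynomial is affine and reaches -1 unless [b = 0]; otherwise it is evaluated at
   its minimizer. *)
rewrite le_eqVlt => /orP[/eqP <- h|c0 /(_ (- b / c))].
  rewrite mulr0; have [->|b0] := eqVneq b 0; first by rewrite expr2 mul0r.
  have := h (- (a + 1) / (2 * b)).
  have -> : a + 2 * (- (a + 1) / (2 * b)) * b + (- (a + 1) / (2 * b)) ^+ 2 * 0 = -1.
    by field.
  by lra.
have -> : a + 2 * (- b / c) * b + (- b / c) ^+ 2 * c = (a * c - b ^+ 2) / c.
  by field; rewrite gt_eqF.
by rewrite ler_pdivlMr // mul0r subr_ge0.
Qed.

(** Comparability with 0 in [R[i]] forces reality, so the radii of the complex-valued norm may be
    taken real. *)
Lemma gt0_real_complex (R : realType) (e : R[i]) : 0 < e ->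
  exists2 r : R, 0 < r & e = r%:C.
Proof.
move=> e0; have := RRe_real (gtr0_real e0) => eE.
by exists (complex.Re e); rewrite ?eE // -ltcR eE.
Qed.

Lemma cvg_real_distP (R : realType) (V : normedModType R[i]) T
    (F : set_system T) {FF : Filter F} (f : T -> V) (l : V) :
  f @ F --> l <->
  forall e : R, 0 < e -> \forall t \near F, `|l - f t| < e%:C.
Proof.
rewrite cvgrPdist_lt; split=> h e e0; first by apply: h; rewrite ltcR.
by have [r r0 ->] := gt0_real_complex e0; apply: h.
Qed.

(** * Norm convergence and Riesz representation *)

Section HilbertConvergence.
Variables (R : realType) (H : hilbertType R).

Lemma rnorm_cvgP T (F : set_system T) {FF : Filter F} (f : T -> H) (l : H) :
  f @ F --> l <->
  forall e : R, 0 < e -> \forall t \near F, rnorm (l - f t) < e.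
Proof.
rewrite cvg_real_distP; split=> h e e0; have := h e e0; apply: filterS => t;
  by rewrite rnormE ltcR.
Qed.

Lemma rnorm_cauchy_cvg T (F : set_system T) {FF : ProperFilter F} (f : T -> H) :
  (forall e : R, 0 < e -> exists x, \forall t \near F, rnorm (x - f t) < e) ->
  cvg (f @ F).
Proof.
move=> h; apply/cauchy_cvgP/cauchyP => e /gt0_real_complex[r r0 ->].
have [x hx] := h r r0; exists x; rewrite /fmap /= nearE in hx *.
by apply: filterS hx => t; rewrite -ball_normE /ball_ /= rnormE ltcR.
Qed.

Lemma rdot_sqr_le (x y : H) : rdot x y ^+ 2 <= rnorm x ^+ 2 * rnorm y ^+ 2.
Proof.
rewrite !rnorm2; apply: discriminant_le => [|t]; first by rewrite -rnorm2 sqr_ge0.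
have := sqr_ge0 (rnorm (x + t%:C *: y)); rewrite rnorm2.
rewrite rdotDl !rdotDr !rdotZl !rdotZr (rdotC y x).
by lra.
Qed.

Lemma rdot_le (x y : H) : `|rdot x y| <= rnorm x * rnorm y.
Proof.
rewrite -(@ler_pXn2r _ 2) ?nnegrE ?mulr_ge0 ?rnorm_ge0 //.
by rewrite real_normK ?num_real // exprMn rdot_sqr_le.
Qed.

Lemma rdot_inj (x y : H) : (forall z, rdot z x = rdot z y) -> x = y.
Proof.
move=> h; apply/eqP; rewrite -subr_eq0; apply/eqP/rnorm0_eq0/eqP.
by rewrite -sqrf_eq0 rnorm2 rdotDr rdotNr h subrr.
Qed.

Lemma cvg_rdot T (F : set_system T) {FF : Filter F} (f : T -> H) (l y : H) :
  f @ F --> l -> (fun t => rdot (f t) y) @ F --> rdot l y.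
Proof.
move=> /rnorm_cvgP h; apply/cvgrPdist_lt => e e0.
(* The added 1 keeps the divisor positive when [y = 0]. *)
have d0 : 0 < rnorm y + 1 by rewrite ltr_wpDl ?rnorm_ge0.
have := h _ (divr_gt0 e0 d0); apply: filterS => t.
rewrite ltr_pdivlMr // => ht; rewrite -rdotNl -rdotDl.
apply: le_lt_trans (rdot_le _ _) (le_lt_trans _ ht).
by rewrite ler_wpM2l ?rnorm_ge0 // lerDl.
Qed.

(* The minimizer of the strictly convex functional |z|^2 - 2 phi z represents
   phi; its sublevel sets form a Cauchy filter by the parallelogram law. *)
Lemma real_riesz (phi : H -> R) (c : R) :
  {morph phi : x y / x + y} -> (forall a x, phi (a%:C *: x) = a * phi x) ->
  (forall x, `|phi x| <= c * rnorm x) ->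
  exists z, forall x, rdot x z = phi x.
Proof.
move=> phiD phiZ phi_le.
pose J z := rnorm z ^+ 2 - 2 * phi z.
(* Completing the square in [rnorm z ^+ 2 - 2 * c * rnorm z]. *)
have J_lb z : - c ^+ 2 <= J z.
  rewrite /J; have := phi_le z; have := ler_norm (phi z).
  by have := sqr_ge0 (rnorm z - c); nra.
have infJ : has_inf (range J).
  by split; [exists (J 0); exists 0|exists (- c ^+ 2) => _ [z _ <-]].
pose I := inf (range J).
have leI z : I <= J z by apply: ge_inf; [exact: infJ.2|exists z].
pose sub (e : R) : set H := [set z | J z < I + e].
pose F := filter_from [set e : R | 0 < e] sub.
have FF : ProperFilter F.
  apply: filter_from_proper => [|e /= e0]; last first.
    have [_ [z _ <-] hz] := inf_adherent e0 infJ.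
    by exists z.
  apply: filter_from_filter; first by exists 1 => /=.
  move=> a b /= a0 b0; exists (Num.min a b); first by rewrite /= lt_min a0.
  move=> z /= hz; split; apply: lt_le_trans hz _;
    by rewrite lerD2l ge_min lexx ?orbT.
(* The squared distance equals $2J(z)+2J(w)-4J((z+w)/2)$, and the midpoint value is at least [I]. *)
have close z w e : J z < I + e -> J w < I + e -> rnorm (z - w) ^+ 2 <= 4 * e.
  move=> hz hw; have := leI ((2^-1)%:C *: (z + w)).
  rewrite /J !rnorm2 !(rdotDl, rdotDr, rdotNl, rdotNr, rdotZl, rdotZr) phiZ phiD.
  by move: hz hw; rewrite /J !rnorm2 (rdotC w z); lra.
have Fsub e : 0 < e -> F (sub e) by move=> e0; exists e.
have : cvg (id @ F).
  apply: rnorm_cauchy_cvg => e e0.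
  have e20 : 0 < e ^+ 2 / 8 by rewrite divr_gt0 ?exprn_gt0.
  have [z hz] := filter_ex (Fsub _ e20).
  exists z; apply: filterS (Fsub _ e20) => w hw.
  have := close _ _ _ hz hw; have := rnorm_ge0 (z - w) => ? ?; nra.
move=> /cvg_ex[z0 /rnorm_cvgP z0P]; exists z0 => x.
(* A near-minimizer [z] within [e] of [z0] is inserted; each of the two errors is at most
   [e * rnorm x]. *)
have var e : 0 < e -> `|rdot x z0 - phi x| <= 2 * e * rnorm x.
  move=> e0; have e20 : 0 < e ^+ 2 by rewrite exprn_gt0.
  have [z [zJ zz0]] := filter_ex (filterI (Fsub _ e20) (z0P _ e0)).
  rewrite /sub /= in zJ.
  (* Since $J(z+tx)\ge I>J(z)-e^2$ for all $t$, a quadratic in $t$ with constant term $e^2$ is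
     nonnegative. *)
  have h1 : `|rdot x z - phi x| <= e * rnorm x.
    rewrite -(@ler_pXn2r _ 2) ?nnegrE ?mulr_ge0 ?rnorm_ge0 ?(ltW e0) //.
    rewrite real_normK ?num_real // exprMn.
    apply: discriminant_le => [|t]; first by rewrite sqr_ge0.
    have := leI (z + t%:C *: x); move: zJ; rewrite /J phiD phiZ !rnorm2.
    by rewrite !(rdotDl, rdotDr, rdotZl, rdotZr) (rdotC z x); lra.
  have := rdot_le x (z0 - z); rewrite rdotDr rdotNr => h2.
  have -> : rdot x z0 - phi x = (rdot x z0 - rdot x z) + (rdot x z - phi x).
    by ring.
  apply: le_trans (ler_normD _ _) _.
  have := rnorm_ge0 x; nra.
apply/eqP; rewrite -subr_eq0 -normr_le0; apply/ler_addgt0Pr => e e0.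
rewrite add0r; set d := 2 * (rnorm x + 1).
have d0 : 0 < d by rewrite mulr_gt0 // ltr_wpDl ?rnorm_ge0.
apply: le_trans (var (e / d) (divr_gt0 e0 d0)) _.
have -> : 2 * (e / d) * rnorm x = e * (2 * rnorm x / d) by field; rewrite gt_eqF.
by rewrite ler_piMr ?ltW // ltr_pdivrMr // mul1r /d; lra.
Qed.

End HilbertConvergence.

(** * Adjoints of bounded operators *)

Section Adjoint.
Variables (R : realType) (H K : hilbertType R) (T : {linear H -> K}).
Hypothesis T_bounded : bounded_op T.

Lemma bounded_opP : exists2 c : R, 0 < c & forall x, rnorm (T x) <= c * rnorm x.
Proof.
have [c hc] := T_bounded; exists (`|c| + 1); first by rewrite ltr_wpDl.
move=> x; have := hc x; rewrite !rnormE -rmorphM lecR => /le_trans; apply.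
by rewrite ler_wpM2r ?rnorm_ge0 // ler_wpDr // ler_norm.
Qed.

(** Riesz applied to [rdot (T u) y] rules out the default value of [xget]. It yields the real part
    of the identity; the imaginary part is the same identity at ['i *: u]. *)
Lemma adjointP x y : hdot (T x) y = hdot x (adjoint T y).
Proof.
rewrite /adjoint; case: xgetP => [z _ /(_ x) //|noz]; exfalso.
have [c c0 hc] := bounded_opP.
have [|a u|u|z hz] := @real_riesz R H (fun u => rdot (T u) y) (c * rnorm y).
- by move=> u v; rewrite linearD rdotDl.
- by rewrite linearZ rdotZl.
- apply: le_trans (rdot_le _ _) _; rewrite mulrAC.
  by rewrite ler_wpM2r ?rnorm_ge0.
apply: (noz z) => u; rewrite !rdot_complexE -hz; congr (_ +i* _).
by rewrite !rdotir -[LHS]opprK -[RHS]opprK -!rdotil hz linearZ.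
Qed.

Lemma rdot_adjoint x y : rdot (T x) y = rdot x (adjoint T y).
Proof. by rewrite /rdot adjointP. Qed.

Lemma adjointD : {morph adjoint T : x y / x + y}.
Proof. by move=> x y; apply: rdot_inj => z; rewrite rdotDr -!rdot_adjoint rdotDr. Qed.

Lemma adjointN : {morph adjoint T : x / - x}.
Proof. by move=> x; apply: rdot_inj => z; rewrite rdotNr -!rdot_adjoint rdotNr. Qed.

Lemma adjointi x : adjoint T ('i *: x) = 'i *: adjoint T x.
Proof.
apply: rdot_inj => z; rewrite -rdot_adjoint !rdotir.
by rewrite adjointP.
Qed.

(** $\|T^*y\|^2=\langle TT^*y,y\rangle\le c\|T^*y\|\|y\|$, and a nonzero factor $\|T^*y\|$
    cancels. *)
Lemma adjoint_bounded :
  exists2 c : R, 0 < c & forall y, rnorm (adjoint T y) <= c * rnorm y.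
Proof.
have [c c0 hc] := bounded_opP; exists c => // y.
have [->|n0] := eqVneq (rnorm (adjoint T y)) 0; first by rewrite mulr_ge0 ?rnorm_ge0 ?ltW.
have n_gt0 : 0 < rnorm (adjoint T y) by rewrite lt_neqAle eq_sym n0 rnorm_ge0.
rewrite -(ler_pM2l n_gt0) -expr2 rnorm2 -rdot_adjoint.
apply: le_trans (ler_norm _) (le_trans (rdot_le _ _) _).
by rewrite mulrA [rnorm _ * c]mulrC ler_wpM2r ?rnorm_ge0.
Qed.

End Adjoint.

(** * Complex nets with real limits, and partial sums over finite sets *)

Lemma cvg_complex_realP (R : realType) T (F : set_system T) {FF : Filter F}
    (z : T -> R[i]^o) (s : R) :
  z @ F --> (s%:C : R[i]^o) ->
  (fun t => complex.Re (z t)) @ F --> s /\ (fun t => complex.Im (z t)) @ F --> 0.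
Proof.
move=> /cvg_real_distP h; split; apply/cvgrPdist_lt => e e0;
  have := h e e0; apply: filterS => t; rewrite -ltcR; apply: le_lt_trans.
- have -> : s - complex.Re (z t) = complex.Re (s%:C - z t) by rewrite ReD ReN.
  exact: normc_ge_Re.
(* Multiplication by ['i] keeps the modulus and reduces this to the bound on real parts. *)
- have -> : 0 - complex.Im (z t) = - complex.Re ('i * (s%:C - z t)).
    by rewrite Rei ImD /=; case: (z t) => ? ? /=; ring.
  rewrite normrN; apply: le_trans (normc_ge_Re _) _.
  by rewrite normrM (normc_def 'i) /= expr0n expr1n add0r sqrtr1 mul1r.
Qed.

Lemma cvg_real_complex (R : realType) T (F : set_system T) {FF : Filter F}
    (v : T -> R) (s : R) :
  v @ F --> s -> (fun t => (v t)%:C : R[i]^o) @ F --> (s%:C : R[i]^o).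
Proof.
move=> /cvgrPdist_lt h; apply/cvg_real_distP => e e0.
have := h e e0; apply: filterS => t; rewrite -ltcR.
by rewrite -rmorphB normc_def /= expr0n addr0 sqrtr_sqr.
Qed.

Lemma partial_sum_subset (I : choiceType) (V : zmodType) (u : I -> V)
    (A B : {fset I}) : (A `<=` B)%fset ->
  partial_sum u B = partial_sum u A + partial_sum u (B `\` A)%fset.
Proof.
move=> AB.
have psE X : partial_sum u X = \sum_(i <- X) u i by rewrite big_seq_fsetE.
rewrite !psE (big_fsetID _ (mem A)) /=.
by congr (_ + _); apply: eq_fbigl => i; rewrite !inE //= ?andbT //;
  [apply/andP/idP => [[]//|iA]; split => //; exact: (fsubsetP AB)|rewrite andbC].
Qed.

#[local] Existing Instance totally_filter.

Lemma nondecreasing_totally_cvg (R : realType) (I : choiceType)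
    (v : {fset I} -> R) (M : R) :
  (forall A B, (A `<=` B)%fset -> v A <= v B) -> (forall A, v A <= M) ->
  v @ totally --> sup (range v).
Proof.
move=> v_homo v_le.
have supv : has_sup (range v).
  by split; [exists (v fset0); exists fset0|exists M => _ [A _ <-]].
apply/cvgrPdist_lt => e e0.
have [_ [A _ <-] hA] := sup_adherent e0 supv.
exists A => // B /= AB; have := v_homo _ _ AB.
have : v B <= sup (range v) by apply: ub_le_sup; [exact: supv.2|exists B].
by move=> h1 h2; rewrite ger0_norm ?subr_ge0 //; lra.
Qed.

(** * Bessel families and strong convergence of the g-frame series *)

Section Bessel.
Variables (R : realType) (J : set int) (H : hilbertType R).
Variables (K : J -> hilbertType R) (Lam : forall i : J, {linear H -> K i}).
Hypothesis Lam_bounded : forall i, bounded_op (Lam i).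
Implicit Types (A B : {fset J}) (f g h : H).

(** The real part of $\langle S_Af,g\rangle$ without adjoints; [rdot_gframe_sum] makes the link. *)
Definition gram A f g : R :=
  partial_sum (fun i => rdot (Lam i f) (Lam i g)) A.

Lemma gramC A f g : gram A f g = gram A g f.
Proof. by apply: eq_bigr => i _; rewrite rdotC. Qed.

Lemma gramDl A f g h : gram A (f + g) h = gram A f h + gram A g h.
Proof.
by rewrite -big_split; apply: eq_bigr => i _; rewrite linearD rdotDl.
Qed.

Lemma gramDr A f g h : gram A h (f + g) = gram A h f + gram A h g.
Proof. by rewrite gramC gramDl !(gramC _ _ h). Qed.

Lemma gramNl A f g : gram A (- f) g = - gram A f g.
Proof. by rewrite -sumrN; apply: eq_bigr => i _; rewrite linearN rdotNl. Qed.

Lemma gramNr A f g : gram A g (- f) = - gram A g f.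
Proof. by rewrite gramC gramNl gramC. Qed.

Lemma gramZl A a f g : gram A (a%:C *: f) g = a * gram A f g.
Proof. by rewrite mulr_sumr; apply: eq_bigr => i _; rewrite linearZ rdotZl. Qed.

Lemma gramii A f g : gram A ('i *: f) ('i *: g) = gram A f g.
Proof. by apply: eq_bigr => i _; rewrite !linearZ rdotii. Qed.

Lemma gram_ge0 A f : 0 <= gram A f f.
Proof. by apply: sumr_ge0 => i _; rewrite -rnorm2 sqr_ge0. Qed.

Lemma gram_sqr_le A f g : gram A f g ^+ 2 <= gram A f f * gram A g g.
Proof.
apply: discriminant_le => [|t]; first exact: gram_ge0.
have := gram_ge0 A (f + t%:C *: g).
by rewrite gramDl !gramDr !gramZl !(gramC _ _ (_ *: _)) !gramZl (gramC _ g f); lra.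
Qed.

Lemma gram_subset A B f : (A `<=` B)%fset -> gram A f f <= gram B f f.
Proof. by move=> AB; rewrite [leRHS](partial_sum_subset _ AB) lerDl gram_ge0. Qed.

Definition gframe_sum A f : H := partial_sum (gframe_series Lam f) A.

Lemma rdot_gframe_sum A f g : rdot (gframe_sum A f) g = gram A f g.
Proof.
rewrite rdot_suml; apply: eq_bigr => i _.
by rewrite /gframe_series rdotC -rdot_adjoint // rdotC.
Qed.

Lemma gframe_op_rdot f g :
  cvg (partial_sum (gframe_series Lam f) @ @totally J) ->
  (fun A => gram A f g) @ @totally J --> rdot (gframe_op Lam f) g.
Proof.
move=> cf.
have -> : (fun A => gram A f g) = (fun A => rdot (gframe_sum A f) g).
  by apply/funext => A; rewrite rdot_gframe_sum.
exact: cvg_rdot.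
Qed.

Variable b : R.
Hypothesis b_gt0 : 0 < b.
Hypothesis gram_le : forall A f, gram A f f <= b * rnorm f ^+ 2.

(** With $w=S_Af$, Cauchy-Schwarz for [gram] at $f,w$ and the Bessel bound at $w$ give $\|w\|^4\le
    b\|w\|^2\langle S_Af,f\rangle$; then $\|w\|^2$ is cancelled. *)
Lemma gframe_sum_le A f : rnorm (gframe_sum A f) ^+ 2 <= b * gram A f f.
Proof.
set w := gframe_sum A f; set n := rnorm w ^+ 2.
have n_ge0 : 0 <= n by rewrite sqr_ge0.
have nE : n = gram A f w by rewrite /n rnorm2 rdot_gframe_sum.
have : n ^+ 2 <= gram A f f * (b * n).
  rewrite {1}nE; apply: le_trans (gram_sqr_le _ _ _) _.
  by rewrite ler_wpM2l ?gram_ge0.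
move: n_ge0; rewrite le_eqVlt => /orP[/eqP n0 _|n0].
  by rewrite -n0 mulr_ge0 ?gram_ge0 ?ltW.
by rewrite expr2 mulrA ler_pM2r // mulrC.
Qed.

Lemma gram_cvg f :
  (fun A => gram A f f) @ @totally J --> sup (range (fun A => gram A f f)).
Proof.
apply: (@nondecreasing_totally_cvg _ _ _ (b * rnorm f ^+ 2)) => [A B|A].
  exact: gram_subset.
exact: gram_le.
Qed.

(** The diagonal sums converge by monotonicity; [gframe_sum_le] on a difference of index sets turns
    this into a Cauchy condition in norm. *)
Lemma gframe_series_cvg f : cvg (partial_sum (gframe_series Lam f) @ @totally J).
Proof.
apply: rnorm_cauchy_cvg => e e0.
have := @gram_cvg f; set s := sup _ => /[dup] cs /cvgrPdist_lt.
(* Two such distances add up to [e ^+ 2 / b], and [gframe_sum_le] restores the factor [b]. *)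
move=> /(_ (e ^+ 2 / b / 2)) [|A _ hA].
  by rewrite !divr_gt0 ?exprn_gt0.
exists (gframe_sum A f); exists A => // B /= AB.
rewrite (partial_sum_subset _ AB) opprD addrA subrr add0r rnormN.
have hB := hA B AB; have {}hA := hA A (fsubset_refl A).
have := gframe_sum_le (B `\` A)%fset f.
have : gram (B `\` A)%fset f f < e ^+ 2 / b.
  have := partial_sum_subset (fun i => rdot (Lam i f) (Lam i f)) AB.
  rewrite -!/(gram _ f f) => gE; move: hA hB; rewrite !ltr_norml gE.
  by move=> /andP[] ? ? /andP[] ? ?; lra.
rewrite ltr_pdivlMr // => h1 h2.
have n0 := rnorm_ge0 (gframe_sum (B `\` A)%fset f).
rewrite -/(gframe_sum _ _) -(@ltr_pXn2r _ 2) ?nnegrE ?(ltW e0) //.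
apply: le_lt_trans h2 (le_lt_trans _ h1).
by rewrite mulrC.
Qed.

End Bessel.

(** * Consequences of the controlled bounds *)

Section Controlled.
Variables (R : realType) (J : set int) (H : hilbertType R).
Variables (K : J -> hilbertType R) (Lam : forall i : J, {linear H -> K i}).
Hypothesis Lam_bounded : forall i, bounded_op (Lam i).
Variables (C : {linear H -> H}) (F : set_system {fset J}).
Hypotheses (C_GL : in_GL C) (F_filter : ProperFilter F).
Hypothesis F_exhausts : F --> @totally J.
Implicit Types (A B : {fset J}) (f g h : H).

Let C_bounded : bounded_op C := C_GL.1.

Let near_totally (P : set {fset J}) : totally P -> F P.
Proof. exact: F_exhausts. Qed.

(** $C^*D^*=(DC)^*$ is the identity. This bounded right inverse lets [gram_bessel] reach any vector
    through $C^*$. *)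
Lemma adjoint_GL_inverse : exists2 D' : H -> H,
  (forall h, adjoint C (D' h) = h) &
  exists2 d : R, 0 < d & forall h, rnorm (D' h) <= d * rnorm h.
Proof.
have [_ [D [D_bounded CD _]]] := C_GL.
exists (adjoint D); last exact: adjoint_bounded.
by move=> h; apply: rdot_inj => z; rewrite -!rdot_adjoint // CD.
Qed.

Variables (m M : R) (q : H -> R).
Hypothesis m_gt0 : 0 < m.
Hypothesis q_ge : forall f, m * rnorm f ^+ 2 <= q f.
Hypothesis q_le : forall f, q f <= M * rnorm f ^+ 2.
Hypothesis q_cvg : forall f,
  (fun A => gram Lam A (adjoint C f) f) @ F --> q f.
Hypothesis Im_cvg : forall f,
  (fun A => gram Lam A (adjoint C f) ('i *: f)) @ F --> 0.

(* Replacing f by f + ig in the imaginary part of the form, which tends to 0,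
   shows that the real part is asymptotically symmetric. *)
Lemma gram_defect_cvg f g :
  (fun A => gram Lam A (adjoint C f) g - gram Lam A (adjoint C g) f) @ F --> 0.
Proof.
have -> : (fun A => gram Lam A (adjoint C f) g - gram Lam A (adjoint C g) f) =
    (fun A => gram Lam A (adjoint C f) ('i *: f) +
      gram Lam A (adjoint C g) ('i *: g) -
      gram Lam A (adjoint C (f + 'i *: g)) ('i *: (f + 'i *: g))).
  apply/funext => A; rewrite scalerDr scalerA.
  have -> : ('i * 'i : R[i]) = -1 by rewrite -expr2 sqr_i.
  rewrite scaleN1r adjointD // adjointi // gramDl !gramDr !gramNr gramii.
  have -> : gram Lam A ('i *: adjoint C g) g = - gram Lam A (adjoint C g) ('i *: g).
    rewrite -(gramii Lam A ('i *: _)) scalerA -expr2 sqr_i scaleN1r.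
    by rewrite gramNl.
  by ring.
have -> : (0 : R) = 0 + 0 - 0 by rewrite subr0 addr0.
by apply: cvgB; [apply: cvgD|]; exact: Im_cvg.
Qed.

(** Polarization yields only twice the sum of [gram] at $(C^*f,g)$ and $(C^*g,f)$; adding twice
    their difference, which tends to 0, leaves four times the first. *)
Lemma gram_adjoint_cvg f g :
  (fun A => gram Lam A (adjoint C f) g) @ F --> (q (f + g) - q (f - g)) / 4.
Proof.
have -> : (fun A => gram Lam A (adjoint C f) g) =
    (fun A => (gram Lam A (adjoint C (f + g)) (f + g) -
      gram Lam A (adjoint C (f - g)) (f - g) +
      2 * (gram Lam A (adjoint C f) g - gram Lam A (adjoint C g) f)) / 4).
  apply/funext => A; rewrite !adjointD // adjointN // !gramDl !gramDr !gramNl !gramNr.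
  by field.
apply: cvgMr_tmp; rewrite -[X in _ --> X]addr0 -[X in _ --> _ + X](mulr0 2).
by apply: cvgD; [apply: cvgB|apply: cvgMl_tmp; exact: gram_defect_cvg].
Qed.

Lemma gram_bessel : exists2 b : R, 0 < b &
  forall A f, gram Lam A f f <= b * rnorm f ^+ 2.
Proof.
have [D' CD' [d d0 D'_le]] := adjoint_GL_inverse.
(* From [rnorm (D' h + h) <= (d + 1) * rnorm h] in the polarized limit, whose other term is dropped
   by sign. The absolute value covers any sign of [M]; the final 1 gives strict positivity. *)
exists (`|M| * (d + 1) ^+ 2 / 4 + 1).
  by rewrite ltr_wpDl // divr_ge0 // mulr_ge0 ?sqr_ge0.
move=> A h.
have : gram Lam A h h <= (q (D' h + h) - q (D' h - h)) / 4.
  (* The limit along [F] dominates the value at [A], since [F] eventually contains only supersets of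
     [A] and the diagonal increases. *)
  apply: (cvgr_to_ge (@gram_adjoint_cvg (D' h) h)).
  apply: near_totally; exists A => // B AB /=.
  by rewrite CD'; exact: gram_subset.
have q0 : 0 <= q (D' h - h).
  by apply: le_trans (q_ge _); rewrite mulr_ge0 ?sqr_ge0 // ltW.
have qM : q (D' h + h) <= `|M| * ((d + 1) ^+ 2 * rnorm h ^+ 2).
  apply: le_trans (q_le _) _.
  apply: le_trans (_ : `|M| * rnorm (D' h + h) ^+ 2 <= _).
    by rewrite ler_wpM2r ?sqr_ge0 // ler_norm.
  rewrite ler_wpM2l // -exprMn ler_pXn2r ?nnegrE ?rnorm_ge0 //.
    by apply: le_trans (rnormD _ _) _; rewrite mulrDl mul1r lerD2r.
  by rewrite mulr_ge0 ?rnorm_ge0 // addr_ge0 // ltW.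
have := sqr_ge0 (rnorm h) => n0 hA.
apply: le_trans hA _.
apply: le_trans (_ : `|M| * ((d + 1) ^+ 2 * rnorm h ^+ 2) / 4 <= _).
  by rewrite ler_wpM2r ?invr_ge0 //; lra.
by rewrite mulrDl mul1r -subr_ge0; apply: le_trans n0 _; rewrite le_eqVlt;
  apply/orP; left; apply/eqP; field.
Qed.

Let series_cvg f : cvg (partial_sum (gframe_series Lam f) @ @totally J).
Proof. by have [b b0 hb] := gram_bessel; exact: (gframe_series_cvg Lam_bounded b0 hb). Qed.

Let gram_sup f := sup (range (fun A => gram Lam A f f)).

Let gram_sup_cvg f : (fun A => gram Lam A f f) @ @totally J --> gram_sup f.
Proof. by have [b b0 hb] := gram_bessel; exact: (gram_cvg hb). Qed.

Let gram_le_sup A f : gram Lam A f f <= gram_sup f.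
Proof.
apply: (cvgr_to_ge (@gram_sup_cvg f)); exists A => // B AB /=.
exact: gram_subset.
Qed.

(* Cauchy-Schwarz: q f is the limit of gram (C^* f) f, and the diagonal at
   C^* f is controlled by the Bessel bound. *)
Lemma gram_sup_ge : exists2 a : R, 0 < a &
  forall f, a * rnorm f ^+ 2 <= gram_sup f.
Proof.
have [b b0 hb] := gram_bessel.
have [c c0 hc] := adjoint_bounded C_bounded.
(* With [n = rnorm f ^+ 2], the bounds $m^2n^2\le q(f)^2\le bc^2n\cdot$[gram_sup f] are divided by
   [n]. *)
exists (m ^+ 2 / (b * c ^+ 2)); first by rewrite divr_gt0 ?mulr_gt0 ?exprn_gt0.
move=> f; set n := rnorm f ^+ 2; have n_ge0 : 0 <= n by rewrite sqr_ge0.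
have s0 : 0 <= gram_sup f := le_trans (gram_ge0 _ _ _) (gram_le_sup fset0 f).
have q2 : q f ^+ 2 <= b * c ^+ 2 * n * gram_sup f.
  rewrite expr2; apply: (cvgr_to_le (cvgM (@q_cvg f) (@q_cvg f))).
  apply: nearW => A; rewrite /GRing.mul_fun /= -expr2.
  apply: le_trans (gram_sqr_le _ _ _ _) _.
  apply: ler_pM; rewrite ?gram_ge0 //; apply: le_trans (hb _ _) _.
  rewrite -mulrA ler_pM2l // -exprMn ler_pXn2r ?nnegrE ?rnorm_ge0 //.
  by rewrite mulr_ge0 ?rnorm_ge0 ?ltW.
move: n_ge0; rewrite le_eqVlt => /orP[/eqP <-|n0]; first by rewrite mulr0.
have bc0 : 0 < b * c ^+ 2 by rewrite mulr_gt0 ?exprn_gt0.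
rewrite mulrAC ler_pdivrMr // -(ler_pM2r n0) [leRHS]mulrAC -[leRHS]mulrA.
rewrite -[leLHS]mulrA -expr2 -exprMn.
apply: le_trans (_ : q f ^+ 2 <= _); last by apply: le_trans q2 _; lra.
have mn0 : 0 <= m * n by apply: mulr_ge0; exact: ltW.
by rewrite ler_pXn2r ?nnegrE ?(le_trans mn0) ?q_ge.
Qed.

(** The defect of symmetry tends to 0 and also to the real part of $\langle SC^*f-CSf,g\rangle$;
    limits along [F] are unique. *)
Lemma gframe_op_adjoint : gframe_op Lam \o adjoint C = C \o gframe_op Lam.
Proof.
apply/funext => f /=; apply: rdot_inj => g; rewrite ![rdot g _]rdotC.
apply/eqP; rewrite -subr_eq0; apply/eqP.
(* Unordered convergence passes to the finer filter [F]. *)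
have cvgF h k : (fun A => gram Lam A h k) @ F --> rdot (gframe_op Lam h) k.
  by apply: cvg_trans (gframe_op_rdot Lam_bounded (@series_cvg h)); apply: cvg_app.
have defect_cvg : (fun A => gram Lam A (adjoint C f) g - gram Lam A (adjoint C g) f)
    @ F --> rdot (gframe_op Lam (adjoint C f)) g - rdot (C (gframe_op Lam f)) g.
  have -> : (fun A => gram Lam A (adjoint C f) g - gram Lam A (adjoint C g) f) =
      (fun A => gram Lam A (adjoint C f) g - gram Lam A f (adjoint C g)).
    by apply/funext => A; rewrite (gramC _ _ f).
  by rewrite rdot_adjoint //; apply: cvgB; exact: cvgF.
exact: (cvg_unique _ defect_cvg (@gram_defect_cvg f g)).
Qed.

Lemma controlled_gframe_is_gframe : gframe Lam.
Proof.
have [b b0 hb] := gram_bessel; have [a a0 ha] := gram_sup_ge.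
exists a, b; split => // f; exists (gram_sup f).
rewrite rnormE -rmorphXn -!rmorphM /= !lecR ha; split => //.
  have -> : partial_sum (fun i => `|Lam i f| ^+ 2 : R[i]^o) =
      (fun A => (gram Lam A f f)%:C).
    apply/funext => A; rewrite /gram /partial_sum rmorph_sum.
    by apply: eq_bigr => i _ /=; rewrite rnormE -rmorphXn rnorm2.
  exact: cvg_real_complex.
by apply: (cvgr_to_le (@gram_sup_cvg f)); apply: nearW => A; exact: hb.
Qed.

End Controlled.

(** * From the complex controlled sums to real data, and the conclusion *)

Lemma controlled_gframeP (R : realType) (J : set int) (H : hilbertType R)
    (K : J -> hilbertType R) (Lam : forall i : J, {linear H -> K i})
    (C : {linear H -> H}) (F : set_system {fset J}) (F_filter : ProperFilter F) :
  controlled_gframe Lam F C ->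
  exists (m M : R) (q : H -> R), [/\ 0 < m,
    forall f, m * rnorm f ^+ 2 <= q f,
    forall f, q f <= M * rnorm f ^+ 2,
    forall f, (fun A => gram Lam A (adjoint C f) f) @ F --> q f &
    forall f, (fun A => gram Lam A (adjoint C f) ('i *: f)) @ F --> 0].
Proof.
move=> [m [M [m0 /choice[q hq]]]]; exists m, M, q; split => // f.
- by have [_ + _] := hq f; rewrite rnormE -rmorphXn -rmorphM lecR.
- by have [_ _] := hq f; rewrite rnormE -rmorphXn -rmorphM lecR.
- have [/cvg_complex_realP[qf _] _ _] := hq f.
  suff -> : (fun A => gram Lam A (adjoint C f) f) = (fun A => complex.Re
      (partial_sum (fun i => hdot (Lam i (adjoint C f)) (Lam i f) : R[i]^o) A)).
    exact: qf.
  by apply/funext => A; rewrite /partial_sum (big_morph _ (@ReD R) erefl).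
- have [/cvg_complex_realP[_ qf] _ _] := hq f.
  suff -> : (fun A => gram Lam A (adjoint C f) ('i *: f)) = (fun A => complex.Im
      (partial_sum (fun i => hdot (Lam i (adjoint C f)) (Lam i f) : R[i]^o) A)).
    exact: qf.
  apply/funext => A; rewrite /partial_sum (big_morph _ (@ImD R) erefl).
  by apply: eq_bigr => i _; rewrite linearZ rdotir.
Qed.

Unset Implicit Arguments.
Set Strict Implicit.
Close Scope complex_scope.

Theorem proposition4p3 (R : realType) (J : set int)
    (H : hilbertType R) (K : J -> hilbertType R)
    (sepH : separable H) (sepK : forall i : J, separable (K i))
    (C : {linear H -> H}) (C_GL : in_GL C)
    (Lam : forall i : J, {linear H -> K i})
    (Lam_bounded : forall i : J, bounded_op (Lam i))
    (F : set_system {fset J}) (F_filter : ProperFilter F)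
    (F_exhausts : F --> @totally J)
    (Lam_ctrl : controlled_gframe Lam F C) :
  [/\ gframe Lam,
      forall f : H, cvg (partial_sum (gframe_series Lam f) @ @totally J),
      gframe_op Lam \o adjoint C = C \o gframe_op Lam
    & forall f : H,
        cvg (partial_sum (fun i : J => adjoint (Lam i) (Lam i (adjoint C f)))
             @ @totally J) /\
        sum (fun i : J => adjoint (Lam i) (Lam i (adjoint C f)))
        = C (sum (fun i : J => adjoint (Lam i) (Lam i f)))].
Proof.
have [m [M [q [m0 q_ge q_le q_cvg Im_cvg]]]] := controlled_gframeP F_filter Lam_ctrl.
have [b b0 hb] := gram_bessel C_GL F_filter F_exhausts m0 q_ge q_le q_cvg Im_cvg.
have scvg f : cvg (partial_sum (gframe_series Lam f) @ @totally J).
  exact: gframe_series_cvg hb f.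
have SC := gframe_op_adjoint Lam_bounded C_GL F_filter F_exhausts m0 q_ge q_le
  q_cvg Im_cvg.
split => //.
  exact: controlled_gframe_is_gframe q_ge q_le q_cvg Im_cvg.
move=> f; split; first exact: (scvg (adjoint C f)).
(* Both sums are [gframe_op] unfolded, so the operator identity at [f] is the claim. *)
exact: (congr1 (@^~ f) SC).
Qed.
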